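(* Let $n\ge 4$ and let $c=(c_1,\dots,c_m)$ be a cardinality sequence with $m\ge 2$, $2\le c_1<\dots<c_m\le n$ and $c\neq(2,3)$. For an arc $(i,j)$ of $\tilde D_n$, the nonnegativity constraint $x_{ij}\ge 0$ defines a facet of $P^{c}_{0,n\text{-path}}(\tilde D_n)$ if and only if either $c\neq(2,n)$, or $c=(2,n)$, $n\ge 5$, and $(i,j)$ is an inner arc.
   Context: $\tilde D_n=(\tilde N_n,\tilde A_n)$ is the digraph with node set $\tilde N_n=\{0,1,\dots,n\}$ and arc set $\tilde A_n=\{(0,i),(i,n): i=1,\dots,n-1\}\cup\{(i,j):1\le i,j\le n-1, i\ne j\}$. An inner arc is an arc $(i,j)$ with $1\le i,j\le n-1$. $P^{c}_{0,n\text{-path}}(\tilde D_n)\subseteq\mathbb{R}^{\tilde A_n}$ is the convex hull of the incidence vectors of simple directed $(0,n)$-paths $P$ in $\tilde D_n$ whose number of arcs $|P|$ equals $c_p$ for some $p$. *)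

(* Defs.v *)
From HB Require Import structures.
From mathcomp Require Import all_boot all_order all_algebra.
From mathcomp Require Import classical_sets reals.

Set Implicit Arguments.
Unset Strict Implicit.
Unset Printing Implicit Defensive.

Import Order.TTheory GRing.Theory Num.Theory.

Local Open Scope ring_scope.
Local Open Scope classical_set_scope.

Section Polyhedral.
Variables (R : realType) (V : lmodType R).

Definition conv_hull (S : set V) : set V :=
  [set x | exists (k : nat) (w : 'I_k -> R) (v : 'I_k -> V),
     [/\ forall i, 0 <= w i, \sum_i w i = 1, forall i, S (v i)
       & x = \sum_i w i *: v i]].

Definition affine_indep (k : nat) (v : 'I_k -> V) : Prop :=
  forall l : 'I_k -> R,
    \sum_i l i = 0 -> \sum_i l i *: v i = 0 -> forall i, l i = 0.

(* The maximal number of affinely independent points of X is d + 1; in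
   particular X is nonempty. *)
Definition has_dim (X : set V) (d : nat) : Prop :=
  (exists v : 'I_d.+1 -> V, (forall i, X (v i)) /\ affine_indep v) /\
  (forall (k : nat) (v : 'I_k -> V),
     (forall i, X (v i)) -> affine_indep v -> (k <= d.+1)%N).

(* The inequality b <= f x (f is meant to be a linear form) is valid for P and
   the face it induces has dimension dim P - 1. *)
Definition defines_facet (P : set V) (f : V -> R) (b : R) : Prop :=
  (forall x, P x -> b <= f x) /\
  exists d : nat, has_dim P d.+1 /\ has_dim (P `&` [set x | f x = b]) d.

End Polyhedral.

Definition inner_node (n : nat) (i : 'I_n.+1) : bool := (0 < i < n)%N.

Definition is_arc (n : nat) : rel 'I_n.+1 := fun i j =>
  [|| (i == ord0) && inner_node j,
      inner_node i && (j == ord_max)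
    | [&& inner_node i, inner_node j & i != j]].

Notation arc_type n := {a : 'I_n.+1 * 'I_n.+1 | is_arc a.1 a.2}.

Definition inner_arc (n : nat) (a : arc_type n) : bool :=
  inner_node (val a).1 && inner_node (val a).2.

(* s lists the nodes visited after node 0. *)
Definition path_arcs (n : nat) (s : seq 'I_n.+1) : {set arc_type n} :=
  [set a : arc_type n | val a \in zip (ord0 :: s) s]%SET.

Definition is_0n_path (n : nat) (P : {set arc_type n}) : Prop :=
  exists s : seq 'I_n.+1,
    [/\ path (@is_arc n) ord0 s, last ord0 s = ord_max, uniq (ord0 :: s)
      & P = path_arcs s].

Definition incidence (R : realType) (n : nat) (P : {set arc_type n}) :
    {ffun arc_type n -> R^o} :=
  [ffun a => (a \in P)%:R].

Definition path_polytope (R : realType) (n : nat) (c : seq nat) :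
    set {ffun arc_type n -> R^o} :=
  conv_hull [set x | exists P : {set arc_type n},
    [/\ is_0n_path P, #|P| \in c & x = incidence R P]].
Arguments path_polytope : clear implicits.

(* Main.v *)
(** Every vertex x satisfies x(δ⁺(0)) = 1, so affine independence of vertices is
    linear independence and x_a >= 0 defines a facet iff every linear form that
    vanishes on the vertices avoiding a is, on all vertices, a multiple of x_a.

    Write a path as the list of its inner nodes; a form is then given by costs
    s (arcs from 0), t (arcs to n) and w (inner arcs).  If some admissible paths
    have between 2 and n - 2 inner nodes, exchanging one end node shows that the
    defect s u + w u v + t v is constant off a, and reversing paths shows that the
    remaining contribution of the interior nodes vanishes.  The lengths (2, n) are
    treated by rotating Hamiltonian cycles of inner nodes; for boundary arcs, or
    for n = 4, an explicit form separates two vertices using a. *)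

Require Import Defs.
From HB Require Import structures.
From mathcomp Require Import all_boot all_order all_algebra.
From mathcomp Require Import boolp classical_sets reals.
From mathcomp Require Import ring lra zify.

Set Implicit Arguments.
Unset Strict Implicit.
Unset Printing Implicit Defensive.

Import Order.TTheory GRing.Theory Num.Theory.
Local Open Scope ring_scope.

(** * Values of paths given as lists of inner nodes *)

Section Walk.
Variables (R : realFieldType) (T : finType).
Implicit Types (s t : T -> R) (w : T -> T -> R) (x y u v p q : T) (l r : seq T).

(** The bounds on the lengths come from the exchanges. An exchange needs an inner node outside the
    path, hence at most n - 2 of the n - 1 inner nodes, and both paths must avoid a. For an inner
    arc two inner nodes are enough. For an arc (0, p) the first node must stay different from p
    while the last one is exchanged, which takes three. Sequences whose only middle length has two
    inner nodes therefore need a separate argument for boundary arcs, one that also uses Hamiltonian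
    paths; this is where the exclusion of (2, 3) enters. Arcs into n are reduced to arcs out of 0 by
    reversing all paths. *)

Fixpoint walk_sum w x r : R :=
  if r is y :: r' then w x y + walk_sum w y r' else 0.

(** The empty list codes no path, since (0, n) is not an arc; its value 0 is a default. *)
Definition path_value s t w l : R :=
  if l is x :: r then s x + walk_sum w x r + t (last x r) else 0.

Lemma walk_sum_cat w x r1 r2 :
  walk_sum w x (r1 ++ r2) = walk_sum w x r1 + walk_sum w (last x r1) r2.
Proof. by elim: r1 x => [|y r1 IH] x /=; rewrite ?add0r // IH addrA. Qed.

Lemma walk_sum_rcons w x r y :
  walk_sum w x (rcons r y) = walk_sum w x r + w (last x r) y.
Proof. by rewrite -cats1 walk_sum_cat /= addr0. Qed.

(** Loops are not arcs, so [w u u] is arbitrary; a list without repetition never reads the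
    diagonal. *)
Lemma eq_walk_sum w1 w2 x r : uniq (x :: r) ->
  (forall u v, u != v -> w1 u v = w2 u v) -> walk_sum w1 x r = walk_sum w2 x r.
Proof.
move=> + H; elim: r x => [|y r IH] x //= /andP[]; rewrite inE negb_or => /andP[xy _] U.
by rewrite H // IH.
Qed.

Lemma eq_path_value s1 s2 t1 t2 w1 w2 l : uniq l -> s1 =1 s2 -> t1 =1 t2 ->
  (forall u v, u != v -> w1 u v = w2 u v) ->
  path_value s1 t1 w1 l = path_value s2 t2 w2 l.
Proof. by case: l => [|x r] //= U -> -> H; rewrite (eq_walk_sum U H). Qed.

Lemma walk_sum_const (K : R) x r : walk_sum (fun _ _ => K) x r = (size r)%:R * K.
Proof. by elim: r x => [|y r IH] x /=; rewrite ?mul0r // IH -[in RHS]natr1 mulrDl mul1r addrC. Qed.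

Lemma walk_sumDZ w1 w2 (d : R) x r :
  walk_sum (fun u v => w1 u v + d * w2 u v) x r = walk_sum w1 x r + d * walk_sum w2 x r.
Proof. by elim: r x => [|y r IH] x /=; rewrite ?IH; ring. Qed.

Lemma last_rev_belast x r : last (last x r) (rev (belast x r)) = x.
Proof.
by rewrite -[LHS]/(last x (last x r :: rev (belast x r))) -rev_rcons -lastI rev_cons last_rcons.
Qed.

Lemma walk_sum_rev w x r :
  walk_sum w (last x r) (rev (belast x r)) = walk_sum (fun u v => w v u) x r.
Proof.
elim: r x => [|y r IH] x //=.
by rewrite rev_cons walk_sum_rcons IH last_rev_belast addrC.
Qed.

Lemma path_value_rev s t w l :
  path_value s t w (rev l) = path_value t s (fun u v => w v u) l.
Proof.
case: l => [|x r] //; rewrite lastI rev_rcons /= -lastI /= walk_sum_rev last_rev_belast.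
by rewrite addrAC [in RHS]addrAC (addrC (s _)).
Qed.

(** This is the value of the two-node path u, v. A potential h can be moved between the costs
    without changing any value (s + h, t - h, and [w u v] - h u + h v); the defect and [s + t] do
    not see it. *)
Definition defect s t w u v : R := s u + w u v + t v.

(* The telescoped form of the value: arcs are charged the potential-free cost
   [defect], which charges every non-extremal node [s + t] in excess. *)
Lemma path_value_defect s t w x r :
  path_value s t w (x :: r) =
  walk_sum (defect s t w) x r - \sum_(z <- x :: r) (s z + t z)
  + (s x + t x) + (s (last x r) + t (last x r)).
Proof.
rewrite /path_value; elim: r x => [|y r IH] x /=; first by rewrite big_seq1; ring.
move: (IH y); rewrite !big_cons /defect => E; move/eqP: E; rewrite -subr_eq0 => /eqP E.
by apply/eqP; rewrite -subr_eq0; apply/eqP; rewrite -[RHS]E; ring.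
Qed.

(** Total of [s + t] over the nodes strictly between the ends. On a one-node list it is
    [- (s x + t x)], the node being subtracted as both ends, which keeps the formula of
    [path_value_const_defect] valid there. *)
Definition mid_excess s t l : R :=
  \sum_(z <- l) (s z + t z) -
  (if l is x :: r then (s x + t x) + (s (last x r) + t (last x r)) else 0).

Lemma mid_excess_rev s t l : mid_excess s t (rev l) = mid_excess s t l.
Proof.
rewrite /mid_excess (perm_big l) ?perm_rev //; case: l => // x r.
rewrite lastI rev_rcons; case: r => //= y r.
by rewrite !rev_cons /= last_rcons (addrC (s x + t x)).
Qed.

Lemma path_value_const_defect s t w K l : uniq l ->
  (forall u v, u != v -> defect s t w u v = K) ->
  path_value s t w l = (size l).-1%:R * K - mid_excess s t l.
Proof.
case: l => [|x r] U H; first by rewrite /mid_excess big_nil /= mul0r !subr0.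
rewrite path_value_defect (eq_walk_sum (w2 := fun _ _ => K)) // walk_sum_const /mid_excess.
by rewrite /=; ring.
Qed.

Lemma defect_last_swap s t w r u v v' :
  path_value s t w (rcons (rcons r u) v) = 0 ->
  path_value s t w (rcons (rcons r u) v') = 0 ->
  defect s t w u v = defect s t w u v'.
Proof.
rewrite /defect; case: r => [|x r] /=; first by move=> *; lra.
by rewrite !walk_sum_rcons !last_rcons => *; lra.
Qed.

Lemma defect_head_swap s t w r u u' v :
  path_value s t w (u :: v :: r) = 0 ->
  path_value s t w (u' :: v :: r) = 0 ->
  defect s t w u v = defect s t w u' v.
Proof. by rewrite /defect /= => *; lra. Qed.

Lemma ex_uniq_extension (z : seq T) k : uniq z -> (size z + k <= #|T|)%N ->
  exists2 r, size r = k & uniq (z ++ r).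
Proof.
move=> Uz Hk; exists (take k (enum [predC z])).
  by rewrite size_takel // -cardE -(leq_add2l (size z)) -(card_uniqP Uz) cardC (card_uniqP Uz).
rewrite cat_uniq Uz take_uniq ?enum_uniq // andbT; apply/hasPn => x /mem_take.
by rewrite mem_enum.
Qed.

Definition arc_at p q u v : R := ((u == p) && (v == q))%:R.

Lemma arc_at_nosource p q x r : p \notin belast x r -> walk_sum (arc_at p q) x r = 0.
Proof.
elim: r x => [|z r IH] x //=; rewrite inE negb_or => /andP[px pr].
by rewrite IH // /arc_at [x == _]eq_sym (negbTE px) addr0.
Qed.

Lemma arc_at_notarget p q x r : q \notin r -> walk_sum (arc_at p q) x r = 0.
Proof.
elim: r x => [|z r IH] x //=; rewrite !inE negb_or => /andP[px pr].
by rewrite IH // /arc_at [z == _]eq_sym (negbTE px) andbF addr0.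
Qed.

(** A walk using both a step from p to q and a step from q to p would repeat a node. *)
Lemma arc_at_antisym p q x r : uniq (x :: r) ->
  walk_sum (arc_at p q) x r = 0 \/ walk_sum (arc_at q p) x r = 0.
Proof.
elim: r x => [|y r IH] x /=; first by left.
rewrite inE negb_or -!andbA => /and3P[xy xr U].
rewrite {1 3}/arc_at; case: (boolP ((x == p) && (y == q))) => [/andP[/eqP ? /eqP ?]|_].
  subst x y; right; rewrite (negbTE xy) add0r; exact: arc_at_notarget.
case: (boolP ((x == q) && (y == p))) => [/andP[/eqP ? /eqP ?]|_].
  subst x y; left; rewrite add0r; exact: arc_at_notarget.
by rewrite !add0r; exact: IH.
Qed.


Definition arc_count p q l : R := path_value (fun _ => 0) (fun _ => 0) (arc_at p q) l.

Lemma arc_count_cons p q x r : arc_count p q (x :: r) = walk_sum (arc_at p q) x r.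
Proof. by rewrite /arc_count /= add0r addr0. Qed.

Lemma arc_count_rcons p q r v : p \notin r -> arc_count p q (rcons r v) = 0.
Proof.
case: r => [|x r] pr; first by rewrite /arc_count /= !addr0.
by rewrite rcons_cons arc_count_cons arc_at_nosource ?belast_rcons.
Qed.

Lemma arc_count_antisym p q l : uniq l ->
  arc_count p q l = 0 \/ arc_count p q (rev l) = 0.
Proof.
case: l => [|x r] U; first by left.
rewrite /arc_count path_value_rev -!/(arc_count _ _ _).
have -> : path_value (fun=> 0) (fun=> 0) (fun u v => arc_at p q v u) (x :: r)
    = arc_count q p (x :: r).
  rewrite /arc_count /= !add0r !addr0; apply: eq_walk_sum => // u v _.
  by rewrite /arc_at andbC.
by rewrite !arc_count_cons; exact: arc_at_antisym.
Qed.

Lemma path_value_arc s t w p q (d : R) l :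
  path_value s t w l =
  path_value s t (fun u v => w u v + - d * arc_at p q u v) l + d * arc_count p q l.
Proof.
case: l => [|x r]; first by rewrite /arc_count /= mulr0 addr0.
rewrite arc_count_cons /=; rewrite walk_sumDZ; ring.
Qed.

(** * Forms vanishing on the paths that avoid an inner arc (p, q) *)

Section Inner.
Variables (len : pred nat) (s t : T -> R) (w : T -> T -> R) (p q : T).
Hypothesis pq : p != q.
Hypothesis vanish : forall l, uniq l -> len (size l) -> arc_count p q l = 0 ->
  path_value s t w l = 0.

Let de := defect s t w.

(** If u is not p, exchanging the last node after u makes row u of [de] constant: p occurs at most
    as last node, so (p, q) is avoided. If v is not q, exchanging the first node before v makes
    column v constant: q occurs at most as first node. The pair (q, p) lies in such a row and in
    such a column, and every pair but (p, q) is linked to it. *)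
Lemma inner_defect_const k : len k -> (2 <= k < #|T|)%N ->
  forall u v, u != v -> ~~ ((u == p) && (v == q)) -> de u v = de q p.
Proof.
move=> lk /andP[k2 kT].
have row u v : u != p -> v != u -> de u v = de u p.
  move=> up vu; have [->//|vp] := eqVneq v p.
  have [||r sr] := @ex_uniq_extension [:: u; v; p] (k - 2)%N; [|by rewrite -[size _]/3%N; lia|].
    by rewrite /= !inE (eq_sym u v) negb_or vu up vp.
  rewrite /= !inE !negb_or => /and4P[/and3P[_ _ ur] /andP[_ vr] pr U].
  have van z : z \notin r -> z != u -> path_value s t w (rcons (rcons r u) z) = 0.
    move=> zr zu; apply: vanish.
    - by rewrite !rcons_uniq mem_rcons inE negb_or zu zr ur U.
    - by rewrite !size_rcons sr -addn2 subnK.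
    - by rewrite arc_count_rcons // mem_rcons inE negb_or eq_sym up pr.
  by apply: (@defect_last_swap _ _ _ r); apply: van; rewrite // eq_sym.
have col u v : v != q -> u != v -> de u v = de q v.
  move=> vq uv; have [->//|uq] := eqVneq u q.
  have [||r sr] := @ex_uniq_extension [:: u; v; q] (k - 2)%N; [|by rewrite -[size _]/3%N; lia|].
    by rewrite /= !inE negb_or uv uq vq.
  rewrite /= !inE !negb_or => /and4P[/and3P[_ _ ur] /andP[_ vr] qr U].
  have van z : z \notin r -> z != v -> path_value s t w (z :: v :: r) = 0.
    move=> zr zv; apply: vanish.
    - by rewrite /= inE negb_or zv zr vr U.
    - by rewrite /= sr -addn2 subnK.
    - by rewrite arc_count_cons arc_at_notarget // inE negb_or eq_sym vq qr.
  by apply: (@defect_head_swap _ _ _ r); apply: van; rewrite // eq_sym.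
move=> u v uv; have [up /= vq|up _] := eqVneq u p; last first.
  by rewrite (row _ v) ?(eq_sym v) //; exact: col.
rewrite {}up in uv *.
by rewrite (col _ v) // (row _ v) // eq_sym.
Qed.

(* A uniq list or its reversal avoids [(p, q)], and once the defect is constant
   the value no longer depends on the orientation. *)
Lemma inner_arc_mid_length k : len k -> (2 <= k < #|T|)%N ->
  exists d, forall l, uniq l -> len (size l) -> path_value s t w l = d * arc_count p q l.
Proof.
move=> lk hk; have K := inner_defect_const lk hk.
(* Lowering the cost of (p, q) by [d] gives this arc the defect [de q p] of all others. *)
set d := de p q - de q p; exists d => l U Ll.
have G l' : uniq l' -> path_value s t w l' =
   (size l').-1%:R * de q p - mid_excess s t l' + d * arc_count p q l'.
  move=> U'; rewrite (path_value_arc _ _ _ p q d); congr (_ + _).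
  apply: path_value_const_defect => // u v uv; rewrite /defect.
  case: (boolP ((u == p) && (v == q))) => uvpq; rewrite /arc_at ?uvpq ?(negbTE uvpq) ?mulr1 ?mulr0.
    by case/andP: uvpq => /eqP -> /eqP ->; rewrite /d /de /defect; ring.
  by rewrite -(K u v) // /de /defect; ring.
rewrite G //; case: (arc_count_antisym p q U) => H.
  by have := vanish U Ll H; rewrite G // H mulr0 addr0.
have := @vanish (rev l); rewrite rev_uniq size_rev G ?rev_uniq // H size_rev mid_excess_rev mulr0 addr0.
by move=> -> //; rewrite add0r.
Qed.

(* The [#|T|] rotations of a Hamiltonian cycle avoiding [(p, q)] are paths of
   value [0], each missing one arc: all arcs of the cycle have the same defect,
   and that defect is [0]. *)
Lemma inner_cycle_defect y l : len 1 -> len #|T| -> (4 <= #|T|)%N ->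
  y != q -> uniq (p :: y :: l) -> size l = #|T|.-2 ->
  [/\ de p y = 0, de (last y l) p = 0 &
      forall l1 u v l2, y :: l = l1 ++ u :: v :: l2 -> de u v = 0].
Proof.
move=> l1 lT T4 yq U sl.
have f0 x : s x + t x = 0.
  have : path_value s t w [:: x] = 0 by apply: vanish; rewrite ?arc_count_cons.
  by rewrite /= addr0.
have pvE x r : path_value s t w (x :: r) = walk_sum de x r.
  by rewrite path_value_defect !f0 big1 ?subr0 ?addr0.
have van l' : perm_eq l' (p :: y :: l) -> arc_count p q l' = 0 -> path_value s t w l' = 0.
  move=> pl; apply: vanish; first by rewrite (perm_uniq pl).
  rewrite (perm_size pl) /= sl; move: lT; have -> // : #|T|.-2.+2 = #|T| by lia.
move: (U) => /=; rewrite inE negb_or => /and3P[/andP[py pl] yl Ul].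
have AC x r : p \notin x :: r -> walk_sum (arc_at p q) x r = 0.
  move=> px; apply: arc_at_nosource; apply: contra px; exact: mem_belast.
have E1 : de p y + walk_sum de y l = 0.
  have := van (p :: y :: l) (perm_refl _); rewrite pvE; apply.
  by rewrite arc_count_cons /= (AC y l) ?inE ?negb_or ?py // /arc_at (negbTE yq) andbF addr0.
have E2 : walk_sum de y l + de (last y l) p = 0.
  have := van (y :: rcons l p); rewrite pvE walk_sum_rcons; apply.
    by rewrite -rcons_cons perm_rcons.
  by rewrite -rcons_cons arc_count_rcons // inE negb_or py.
set C := de p y in E1 *.
have E12 : de (last y l) p = C by move: E1 E2; lra.
(* Cutting the cycle at (u, v) gives the path [v :: l2 ++ p :: rcons l1' u]; comparison with [E1]
   yields [de u v = de (last y l) p]. *)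
have E3 l1' u v l2 : y :: l = l1' ++ u :: v :: l2 -> de u v = C.
  move=> E; rewrite -/(walk_sum de p (y :: l)) E -cat_rcons walk_sum_cat /= last_rcons in E1.
  have [r' Er] : exists r', rcons l1' u = y :: r'.
    by case: l1' E {E1} => [|z l1' [<- _]] /=; [case=> <-; exists [::] | exists (rcons l1' u)].
  have lE : last v l2 = last y l by rewrite -[RHS]/(last y (y :: l)) E last_cat.
  have pE : perm_eq (v :: l2 ++ p :: rcons l1' u) (p :: y :: l).
    by rewrite -[v :: l2 ++ _]/((v :: l2) ++ _) perm_catC E -(cat_rcons u) perm_refl.
  have : p \notin y :: l by rewrite inE negb_or py.
  rewrite E -cat_rcons mem_cat negb_or Er => /andP[pr pv].
  have : path_value s t w (v :: l2 ++ p :: rcons l1' u) = 0.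
    apply: van pE _; rewrite Er arc_count_cons walk_sum_cat /= (AC v) // (AC y) //.
    by rewrite /arc_at (negbTE yq) (negbTE pq) !andbF !addr0.
  by rewrite pvE walk_sum_cat /= lE; move: E1 E12; lra.
have E4 x r : (forall l1' u v l2, x :: r = l1' ++ u :: v :: l2 -> de u v = C) ->
    walk_sum de x r = (size r)%:R * C.
  elim: r x => [|z r IH] x H /=; first by rewrite mul0r.
  rewrite (H [::] x z r) // IH => [|l1' u v l2 E]; last by apply: (H (x :: l1')); rewrite E.
  by rewrite -[in RHS]natr1; ring.
(* The path p, y, l has [size l + 1] arcs, all of defect [C], and value 0. *)
have C0 : C = 0.
  move: E1; rewrite (E4 _ _ E3) -[C in C + _]mul1r -mulrDl nat1r => /eqP.
  by rewrite mulf_eq0 pnatr_eq0 => /eqP.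
by split=> [||l1' u v l2 /E3 ->] //; rewrite E12.
Qed.

(** One-node paths give [s + t = 0]. Every arc other than (p, q) lies on a Hamiltonian cycle
    avoiding (p, q), so its defect is 0 and only the defect of (p, q) is left. With three nodes a
    single cycle avoids (p, q), and arcs entering p or leaving q may miss it; hence the fourth
    node. *)
Lemma inner_arc_extreme_lengths : len 1 -> len #|T| -> (4 <= #|T|)%N ->
  exists d, forall l, uniq l -> path_value s t w l = d * arc_count p q l.
Proof.
move=> l1 lT T4; have cyc y l := @inner_cycle_defect y l l1 lT T4.
have f0 x : s x + t x = 0.
  have : path_value s t w [:: x] = 0 by apply: vanish; rewrite ?arc_count_cons.
  by rewrite /= addr0.
exists (de p q) => l U; rewrite (path_value_arc _ _ _ p q (de p q)).
rewrite (@path_value_const_defect _ _ _ 0) // => [|u v uv].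
  rewrite /mid_excess big1 => [|z _]; last exact: f0.
  by case: (l) => [|x r]; rewrite ?f0; ring.
suff : ~~ ((u == p) && (v == q)) -> de u v = 0.
  rewrite /defect; case: (boolP ((u == p) && (v == q))) => uvpq; rewrite /arc_at ?uvpq ?(negbTE uvpq) ?mulr1 ?mulr0.
    by case/andP: uvpq => /eqP -> /eqP -> _; rewrite /de /defect; ring.
  by move=> /(_ isT) H; rewrite -[RHS]H /de /defect; ring.
have ext (z : seq T) k : uniq z -> (size z + k)%N = #|T| -> exists2 r, size r = k & uniq (z ++ r).
  by move=> Uz e; apply: ex_uniq_extension; rewrite // e.
have avoid (z : seq T) : (size z < #|T|)%N -> exists y, y \notin z.
  move=> sz; apply/existsP; apply: contraTT sz => /existsPn H; rewrite -leqNgt.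
  have e : z =i T by move=> x; have := H x; rewrite negbK => ->.
  by rewrite -(eq_card e) card_size.
(* The cycles used in the four cases, read from p: p, v, ...; p, y, ..., u; p, u, v, ...; p, y, q,
   v, ..., where y is a further node different from q. *)
have [up|up _] := eqVneq u p.
  rewrite {}up /= in uv * => vq.
  have [||r sr Ur] := ext [:: p; v] #|T|.-2; [by rewrite /= inE uv|by rewrite -[size _]/2%N; clear -T4; lia|].
  by case: (cyc v r vq Ur sr).
have [vp|vp] := eqVneq v p.
  rewrite {}vp in uv *; have [|y] := avoid [:: p; q; u]; first exact: leq_trans T4.
  rewrite !inE !negb_or => /and3P[yp yq yu].
  have [||r sr] := ext [:: p; y; u] (#|T| - 3)%N; [|by rewrite -[size _]/3%N; clear -T4; lia|].
    by rewrite /= !inE negb_or !(eq_sym p) yp up yu.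
  rewrite -[_ ++ r]/([:: p, y, u & r]) => Ur.
  have pe : perm_eq [:: p, y & rcons r u] [:: p, y, u & r] by rewrite !perm_cons perm_rcons.
  rewrite -(perm_uniq pe) in Ur.
  have [|_ + _] := cyc y (rcons r u) yq Ur; first by rewrite size_rcons sr; clear -T4; lia.
  by rewrite last_rcons.
have [uq|uq] := eqVneq u q; last first.
  have [||r sr Ur] := ext [:: p; u; v] (#|T| - 3)%N; [|by rewrite -[size _]/3%N; clear -T4; lia|].
    by rewrite /= !inE negb_or !(eq_sym p) up vp uv.
  have [|_ _ H] := cyc u (v :: r) uq Ur; first by rewrite -[size _]/(size r).+1 sr; clear -T4; lia.
  exact: (H [::] u v r).
rewrite {}uq in up uv *; have [|y] := avoid [:: p; q; v]; first exact: leq_trans T4.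
rewrite !inE !negb_or => /and3P[yp yq yv].
have [||r sr Ur] := ext [:: p; y; q; v] (#|T| - 4)%N; [|by rewrite -[size _]/4%N; clear -T4; lia|].
  by rewrite /= !inE !negb_or !(eq_sym p) yp up vp yq yv uv.
have [|_ _ H] := cyc y (q :: v :: r) yq Ur; first by rewrite -[size _]/(size r).+2 sr; clear -T4; lia.
exact: (H [:: y] q v r).
Qed.

End Inner.
End Walk.

(** * Forms vanishing on the paths that do not start with the arc (0, p) *)

Section Start.
Variables (R : realFieldType) (T : finType).
Implicit Types (x y u v : T) (l r : seq T).
Variables (len : pred nat) (s t : T -> R) (w : T -> T -> R) (p : T).
Hypothesis vanish : forall x r, uniq (x :: r) -> len (size r).+1 -> x != p ->
  path_value s t w (x :: r) = 0.

Let de := defect s t w.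

(** The exchange after u needs a prefix starting away from p. The prefix is non-empty since 3 <= k,
    and it avoids p if p is u or one of the exchanged nodes. In the remaining case both entries are
    compared with [de u p]. *)
Lemma start_row_const k u v v' : len k -> (3 <= k < #|T|)%N ->
  v != u -> v' != u -> de u v = de u v'.
Proof.
move=> lk /andP[k3 kT].
have row z z' : z != u -> z' != u -> z' != z -> p \in [:: u; z; z'] -> de u z = de u z'.
  move=> zu z'u zz' pin.
  have [||r sr] := @ex_uniq_extension _ [:: u; z; z'] (k - 2)%N; [|by rewrite -[size _]/3%N; lia|].
    by rewrite /= !inE negb_or !(eq_sym u) zu z'u (eq_sym z) zz'.
  case: r sr => [|x r sr]; first by move=> /= sr; lia.
  rewrite cat_uniq => /and3P[_ /hasPn H U].
  have xp : x != p by apply: contraTneq pin => <-; apply: H; rewrite mem_head.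
  have nin y : y \in [:: u; z; z'] -> y \notin x :: r by move=> yi; apply/negP => /H; rewrite /= yi.
  have van y : y \in [:: z; z'] -> y != u -> path_value s t w (rcons (rcons (x :: r) u) y) = 0.
    move=> yi yu; rewrite !rcons_cons; apply: vanish => //.
      rewrite -!rcons_cons !rcons_uniq U mem_rcons inE negb_or yu !nin //.
        by rewrite inE eqxx.
      by move: yi; rewrite !inE => ->; rewrite orbT.
    by rewrite !size_rcons; move: lk sr => /= + sr; have -> : k = (size r).+3 by lia.
  by apply: (@defect_last_swap _ _ _ _ _ (x :: r)); apply: van; rewrite ?inE ?eqxx ?orbT.
move=> vu v'u; have [->//|vv'] := eqVneq v v'.
have [up|up] := eqVneq u p; first by apply: row; rewrite // 1?eq_sym // up mem_head.
have [vp|vp] := eqVneq v p; first by apply: row; rewrite // 1?eq_sym // vp !inE eqxx orbT.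
have [v'p|v'p] := eqVneq v' p; first by apply: row; rewrite // 1?eq_sym // v'p !inE eqxx !orbT.
have [] : de u v = de u p /\ de u v' = de u p by split; apply: row; rewrite // 1?eq_sym // !inE eqxx !orbT.
by move=> -> ->.
Qed.

Lemma start_col_const k u u' v : len k -> (3 <= k < #|T|)%N ->
  u != p -> u' != p -> u != v -> u' != v -> de u v = de u' v.
Proof.
move=> lk /andP[k3 kT] up u'p uv u'v; have [->//|uu'] := eqVneq u u'.
have [||r sr] := @ex_uniq_extension _ [:: u; u'; v] (k - 2)%N; [|by rewrite -[size _]/3%N; lia|].
  by rewrite /= !inE negb_or uu' uv u'v.
rewrite /= !inE !negb_or => /and4P[/and3P[_ _ ur] /andP[_ u'r] vr U].
apply: (@defect_head_swap _ _ _ _ _ r); apply: vanish; rewrite //= ?inE ?negb_or ?uv ?u'v ?ur ?u'r ?vr //.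
  by move: lk; have -> : k = (size r).+2 by clear -sr k3; lia.
by move: lk; have -> : k = (size r).+2 by clear -sr k3; lia.
Qed.

(** Lowering [s p] by [d] makes all defects equal to [K]. A path starting with p then has the value
    of its reversal, which starts elsewhere, unless it consists of p alone; that path needs its own
    comparison. *)
Lemma start_arc_mid_length k : len k -> (3 <= k < #|T|)%N ->
  exists d, forall x r, uniq (x :: r) -> len (size r).+1 ->
    path_value s t w (x :: r) = d * (x == p)%:R.
Proof.
move=> lk hk; have [k3 kT] := andP hk.
have [||[|u0 [|v0 []]] // _] := @ex_uniq_extension _ [:: p] 2; [by []|by rewrite -[size _]/1%N; lia|].
rewrite [uniq _]/= !inE !negb_or andbT => /andP[/andP[pu0 pv0] uv0].
set K := de u0 p; set d := de p v0 - K.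
pose s' x := s x - d * (x == p)%:R.
have dK u v : u != v -> defect s' t w u v = K.
  move=> uv; rewrite /defect /s'; have [up|up] := eqVneq u p.
    rewrite {}up in uv *; have : de p v = de p v0 by apply: (start_row_const lk hk); rewrite eq_sym.
    by rewrite mulr1 /d /de /defect => E; move: E; lra.
  rewrite mulr0 subr0; transitivity (de u p).
    by apply: (start_row_const lk hk); rewrite eq_sym.
  by apply: (start_col_const lk hk); rewrite // eq_sym.
have G l : uniq l -> path_value s' t w l = (size l).-1%:R * K - mid_excess s' t l.
  by move=> U; apply: path_value_const_defect.
have pvE x r : path_value s t w (x :: r) = path_value s' t w (x :: r) + d * (x == p)%:R.
  by rewrite /path_value /s'; ring.
exists d => x r U Lr; rewrite pvE; suff -> : path_value s' t w (x :: r) = 0 by rewrite add0r.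
have Gx y r' : uniq (y :: r') -> len (size r').+1 -> y != p -> path_value s' t w (y :: r') = 0.
  by move=> U' L' yp; have := vanish U' L' yp; rewrite pvE (negbTE yp) mulr0 addr0.
have [xp|xp] := eqVneq x p; last exact: Gx.
case: r U Lr => [|y r] U Lr.
  rewrite {}xp in U *; rewrite /=.
  (* Two admissible paths differing in a single interior node, p or [u0], show that [s' + t] agrees
     at p and [u0]; it is 0 at [u0] because the path [u0] is then admissible too. *)
  have [||z sz] := @ex_uniq_extension _ [:: p; u0] k.-1; [by rewrite /= inE pu0|by rewrite -[size _]/2%N; lia|].
  case: z sz => [|e1 [|e2 r0]] sz; [move: sz; rewrite /=; lia| move: sz; rewrite /=; lia|] => Uz.
  have Up z : z \in [:: p; u0] -> uniq (e1 :: z :: rcons r0 e2).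
    move=> zi; have := cat_uniq [:: p; u0] [:: e1, e2 & r0]; rewrite Uz => /esym/and3P[_ /hasPn H Ur].
    have zn : z \notin [:: e1, e2 & r0] by apply/negP => /H; rewrite /= zi.
    have pe : perm_eq (e1 :: z :: rcons r0 e2) (z :: [:: e1, e2 & r0]).
      rewrite -[_ :: _ :: rcons _ _]/([:: e1] ++ [:: z] ++ rcons r0 e2) perm_catCA /= !perm_cons.
      by rewrite perm_rcons.
    by rewrite (perm_uniq pe) /= zn.
  have van z : z \in [:: p; u0] -> path_value s' t w (e1 :: z :: rcons r0 e2) = 0.
    move=> zi; apply: Gx; first exact: Up.
      by rewrite /= size_rcons; move: lk sz => /= + sz; have -> : k = (size r0).+3 by lia.
    have : uniq (e1 :: p :: rcons r0 e2) by apply: Up; rewrite mem_head.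
    by rewrite /= inE negb_or => /andP[/andP[]].
  have := van p (mem_head _ _); have := van u0; rewrite !inE eqxx orbT => /(_ isT).
  have E0 : s' u0 + t u0 = 0.
    have : path_value s' t w [:: u0] = 0 by apply: Gx; rewrite // eq_sym.
    by rewrite /= addr0.
  rewrite !G; try (apply: Up; by rewrite !inE eqxx ?orbT).
  by rewrite /mid_excess /= !big_cons !last_rcons !size_rcons E0 addr0; lra.
have := G _ U; rewrite -mid_excess_rev -size_rev -G ?rev_uniq // => ->.
rewrite lastI rev_rcons; apply: Gx.
- by rewrite -rev_rcons -lastI rev_uniq.
- by rewrite size_rev size_belast.
- have /andP[xn _] : (x \notin y :: r) && uniq (y :: r) := U.
  by rewrite -xp /=; apply: contraNneq xn => <-; exact: mem_last.
Qed.

(* Two-node paths kill the defect of all arcs not leaving [p]; Hamiltonian paths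
   ending in [p] then kill [s + t] outside [p], and those passing through [p]
   determine the defect of the arcs leaving [p]. *)
Lemma start_arc_two_and_full : len 2 -> len #|T| -> (3 <= #|T|)%N ->
  exists d, forall x r, uniq (x :: r) -> path_value s t w (x :: r) = d * (x == p)%:R.
Proof.
move=> l2 lT T3; pose f z := s z + t z.
have de0 u v : u != p -> u != v -> de u v = 0.
  move=> up uv; have : path_value s t w [:: u; v] = 0 by apply: vanish; rewrite //= inE uv.
  by rewrite /de /defect /=; lra.
have walk0 x r : uniq (x :: r) -> p \notin belast x r -> walk_sum de x r = 0.
  elim: r x => [|y r IH] x //= /andP[]; rewrite !inE !negb_or => /andP[xy _] U /andP[px pr].
  by rewrite IH // de0 ?addr0 // eq_sym.
have full l : uniq l -> size l = #|T| -> perm_eq l (enum T).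
  move=> U sl; have sub : {subset l <= enum T} by move=> x _; rewrite mem_enum.
  have [|_ e] := uniq_min_size U sub; first by rewrite -cardE sl.
  by apply: uniq_perm; rewrite ?enum_uniq.
have van x r : uniq (x :: r) -> (size r).+1 = #|T| -> x != p -> path_value s t w (x :: r) = 0.
  by move=> U sr xp; apply: vanish; rewrite // sr.
(* [F] is the total of [f] outside p. A Hamiltonian path from x to p has value [f x - F], so [f]
   equals [F] at every node other than p. *)
set F := \sum_(z <- enum T) f z - f p.
have ext x : x != p -> exists2 r, size r = #|T|.-2 & uniq (x :: rcons r p).
  move=> xp; have [||r sr Ur] := @ex_uniq_extension _ [:: p; x] #|T|.-2.
  - by rewrite /= inE eq_sym xp.
  - by rewrite -[size _]/2%N; lia.
  by exists r; rewrite // -rcons_cons rcons_uniq.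
have vanF x r : x != p -> size r = #|T|.-2 -> uniq (x :: rcons r p) ->
    f x = F /\ \sum_(z <- r) f z = 0.
  move=> xp sr U; have sr1 : (size (rcons r p)).+1 = #|T| by rewrite size_rcons; lia.
  have := van x _ U sr1 xp; rewrite path_value_defect walk0 //; last first.
    by rewrite belast_rcons; move: U; rewrite -rcons_cons rcons_uniq => /andP[].
  rewrite last_rcons /F -(perm_big _ (full _ U sr1)) /=.
  by rewrite big_cons -cats1 big_cat big_seq1 /= /f => H; split; move: H; lra.
(* The interior nodes of such a path have total 0, while each of these #|T| - 2 >= 1 nodes
   contributes [F]. *)
have F0 : F = 0.
  have [||[|x0 []] // _] := @ex_uniq_extension _ [:: p] 1; [by []|by rewrite -[size _]/1%N; lia|].
  rewrite [uniq _]/= inE andbT eq_sym => xp; have [r sr Ur] := ext x0 xp.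
  have [_] := vanF _ _ xp sr Ur.
  have pr : p \notin r by move: Ur; rewrite -rcons_cons rcons_uniq inE negb_or => /andP[/andP[]].
  rewrite big_seq (eq_bigr (fun=> F)) => [|z zr]; last first.
    have zp : z != p by apply: contraNneq pr => <-.
    by have [r' sr' Ur'] := ext z zp; case: (vanF _ _ zp sr' Ur').
  rewrite -big_seq big_const_seq count_predT iter_addr_0 sr => /eqP.
  by rewrite mulrn_eq0 => /orP[/eqP|/eqP //]; lia.
have f0 x : x != p -> f x = 0.
  by move=> xp; have [r sr Ur] := ext x xp; have [-> _] := vanF _ _ xp sr Ur.
have dep y : p != y -> de p y = f p.
  move=> py; have [||[|x r] sr Ur] := @ex_uniq_extension _ [:: p; y] #|T|.-2.
  - by rewrite /= inE py.
  - by rewrite -[size _]/2%N; lia.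
  - by move: sr; rewrite -[size _]/0%N; lia.
  have pe : perm_eq [:: x, p, y & r] [:: p, y, x & r].
    by rewrite -(cat1s x) -[[:: p, y & r]]/([:: p; y] ++ r) perm_catCA.
  have U : uniq [:: x, p, y & r] by rewrite (perm_uniq pe).
  move: (U) => /=; rewrite !inE !negb_or => /and4P[/and3P[xp xy _] /andP[_ pr] yr Ur'].
  have pyr : p \notin y :: r by rewrite inE negb_or py.
  have : path_value s t w [:: x, p, y & r] = 0.
    by apply: van; rewrite // -[size _]/(size r).+2; move: sr; rewrite -[size _]/(size r).+1; clear -T3; lia.
  rewrite path_value_defect [walk_sum _ _ _]/= -/de (de0 x p) // walk0 /= ?yr //; last first.
    by apply: contra pyr; exact: mem_belast.
  rewrite !big_cons -!/(f _) (f0 x) // (f0 y) 1?eq_sym // (f0 (last y r)); last first.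
    by apply: contraNneq pyr => <-; exact: mem_last.
  rewrite (_ : \sum_(z <- r) _ = 0); first by lra.
  by rewrite big_seq big1 // => z zr; apply: f0; apply: contraNneq pr => <-.
(* Both [s + t] at p and the defect of every arc leaving p equal [f p], so lowering [s p] by [f p]
   kills both. *)
exists (f p) => x r U; pose s' z := s z - f p * (z == p)%:R.
have -> : path_value s t w (x :: r) = path_value s' t w (x :: r) + f p * (x == p)%:R.
  by rewrite /path_value /s'; ring.
have f0' z : s' z + t z = 0.
  rewrite /s'; have [->|/f0] := eqVneq z p; first by rewrite mulr1 /f; ring.
  by rewrite mulr0 /f; lra.
rewrite (@path_value_const_defect _ _ _ _ _ 0) // => [|u v uv].
  rewrite /mid_excess big1 => [|z _]; last exact: f0'.
  by rewrite !f0'; ring.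
rewrite /defect /s'; have [up|up] := eqVneq u p.
  by rewrite {}up in uv *; move: (dep v uv); rewrite mulr1 /de /defect /f; lra.
by have := de0 u v up uv; rewrite mulr0 /de /defect; lra.
Qed.

End Start.

(** * Dimension and facets of convex hulls *)

Section Dimension.
Variables (R : realType) (V : vectType R).
Implicit Types (X : set V) (Y : seq V) (f h : {linear V -> R^o}).

(** Points witnessing a dimension must lie in the set itself, so the basis is chosen among the
    spanning vectors. *)
Lemma sub_basis Y : exists2 B : seq V, {subset B <= Y} & basis_of <<Y>> B.
Proof.
elim: Y => [|y Y [B sB /andP[/eqP spB fB]]].
  by exists [::] => //; rewrite /basis_of nil_free eqxx.
case: (boolP (y \in <<B>>%VS)) => yB.
  exists B; first by move=> x /sB; rewrite inE orbC => ->.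
  rewrite /basis_of fB andbT span_cons -spB eq_sym; apply/eqP/addv_idPr.
  by rewrite -memvE.
exists (y :: B); last by rewrite /basis_of free_cons yB fB !span_cons spB eqxx.
by move=> x; rewrite !inE => /orP[->//|/sB ->]; rewrite orbT.
Qed.

(* All points lie on the hyperplane [h = 1], so affine and linear independence agree. *)
Lemma has_dim_span h X Y d :
  (forall x, X x -> x \in <<Y>>%VS /\ h x = 1) -> (forall y, y \in Y -> X y) ->
  has_dim X d <-> \dim <<Y>>%VS = d.+1.
Proof.
move=> XY YX.
have indepP k (v : 'I_k -> V) : (forall i, X (v i)) -> affine_indep v <-> free [tuple v i | i < k].
  move=> Xv; split=> [ind|fr l _ ls i].
    apply/freeP => l ls; have ls' : \sum_i l i *: v i = 0.
      by rewrite -[RHS]ls; apply: eq_bigr => i _; rewrite -tnth_nth tnth_mktuple.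
    apply: ind => //; have := congr1 h ls'; rewrite linear_sum linear0 => E.
    rewrite -[RHS]E; apply: eq_bigr => i _; rewrite linearZ /=.
    by have [_ ->] := XY _ (Xv i); rewrite /GRing.scale /= mulr1.
  move/freeP: fr => /(_ l); apply; rewrite -[RHS]ls; apply: eq_bigr => j _.
  by rewrite -tnth_nth tnth_mktuple.
have ub k (v : 'I_k -> V) : (forall i, X (v i)) -> affine_indep v -> (k <= \dim <<Y>>%VS)%N.
  move=> Xv /(indepP _ _ Xv) fr.
  have <- : size [tuple v i | i < k] = k by rewrite size_tuple.
  have /eqP <- := fr; apply: dimvS; apply/span_subvP => x /mapP[i _ ->].
  by case: (XY _ (Xv i)).
have lb : exists v : 'I_(\dim <<Y>>%VS) -> V, (forall i, X (v i)) /\ affine_indep v.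
  have [B sB bB] := sub_basis Y; have sz : size B = \dim <<Y>>%VS.
    by case/andP: bB => /eqP <- /eqP.
  exists (fun i => B`_i); have Xv (i : 'I_(\dim <<Y>>%VS)) : X B`_i.
    by apply/YX/sB/mem_nth; rewrite sz.
  split=> //; apply/indepP => //.
  suff -> : tval [tuple B`_i | i < \dim <<Y>>%VS] = B by case/andP: bB.
  by rewrite /= -{2}(mkseq_nth 0 B) /mkseq -sz -val_enum_ord -map_comp.
split=> [[[v [Xv iv]] ubd]|E]; last by split; [rewrite -E|move=> k v Xv iv; rewrite -E; exact: ub].
apply/eqP; rewrite eqn_leq (ub _ _ Xv iv) andbT.
by have [v' [Xv' iv']] := lb; exact: ubd Xv' iv'.
Qed.

Local Open Scope classical_set_scope.

Lemma mem_conv_hull (S : set V) x : S x -> conv_hull S x.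
Proof.
move=> Sx; exists 1, (fun=> 1), (fun=> x); split=> [_||//|].
- exact: ler01.
- by rewrite big_ord1.
- by rewrite big_ord1 scale1r.
Qed.

(** * Facets of a polytope with vertex list Y, in terms of spans *)

Section Facet.
Variables (h f : {linear V -> R^o}) (Y : seq V).
Hypotheses (hY : forall y, y \in Y -> h y = 1)
  (fY : forall y, y \in Y -> f y = 0 \/ f y = 1).

Let Y0 := [seq y <- Y | f y == 0].

Lemma conv_hull_span x : conv_hull [set y | y \in Y] x -> x \in <<Y>>%VS /\ h x = 1.
Proof.
case=> k [w [v [w0 w1 vY ->]]]; split.
  by apply: memv_suml => i _; apply/memvZ/memv_span/vY.
rewrite linear_sum -[RHS]w1; apply: eq_bigr => i _.
by rewrite linearZ /= hY ?vY // /GRing.scale /= mulr1.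
Qed.

Lemma conv_hull_ge0 x : conv_hull [set y | y \in Y] x -> 0 <= f x.
Proof.
case=> k [w [v [w0 w1 vY ->]]]; rewrite linear_sum; apply: sumr_ge0 => i _.
rewrite linearZ; apply: mulr_ge0 => //.
by case: (fY (vY i)) => ->; rewrite ?ler01.
Qed.

(** As [f] is nonnegative on Y, [f x = 0] forces [f] to vanish at every point of positive weight. *)
Lemma conv_hull_face_span x : conv_hull [set y | y \in Y] x -> f x = 0 -> x \in <<Y0>>%VS.
Proof.
case=> k [w [v [w0 w1 vY ->]]]; rewrite linear_sum => /eqP.
rewrite psumr_eq0 => [/allP H|i _]; last first.
  by rewrite linearZ; apply: mulr_ge0 => //; case: (fY (vY i)) => ->; rewrite ?ler01.
apply: memv_suml => i _; have : w i * f (v i) == 0.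
  by have := H i (mem_index_enum i); rewrite /= linearZ.
rewrite mulf_eq0 => /orP[/eqP ->|fv]; first by rewrite scale0r mem0v.
by apply/memvZ/memv_span; rewrite mem_filter fv; exact: vY.
Qed.

(** On the hyperplane [h = 1] the linear dimension is the affine one plus one; the positivity
    expresses that the face is non-empty, as [has_dim] demands. *)
Lemma defines_facet_dim :
  defines_facet (conv_hull [set y | y \in Y]) f 0 <->
  (0 < \dim <<Y0>>)%N /\ \dim <<Y>>%VS = (\dim <<Y0>>%VS).+1.
Proof.
have D1 d : has_dim (conv_hull [set y | y \in Y]) d <-> \dim <<Y>>%VS = d.+1.
  by apply: (@has_dim_span h) => [x|y yY]; [exact: conv_hull_span | exact: mem_conv_hull].
have D0 d : has_dim (conv_hull [set y | y \in Y] `&` [set x | f x = 0]) d <->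
    \dim <<Y0>>%VS = d.+1.
  apply: (@has_dim_span h) => [x [Cx fx]|y].
    by split; [exact: conv_hull_face_span | case: (conv_hull_span Cx)].
  by rewrite mem_filter => /andP[/eqP fy yY]; split=> //; exact: mem_conv_hull.
split=> [[_ [d [/D1 -> /D0 ->]]] //|[d0 E]]; split; first exact: conv_hull_ge0.
exists (\dim <<Y0>>%VS).-1; split; [apply/D1|apply/D0]; rewrite prednK //.
Qed.

Lemma form_eq0_span (e : {linear V -> R^o}) (B : seq V) x :
  (forall y, y \in B -> e y = 0) -> x \in <<B>>%VS -> e x = 0.
Proof.
move=> e0 xB; rewrite (coord_span (X := in_tuple B) xB) linear_sum big1 // => i _.
by rewrite linearZ /= e0 ?scaler0 // mem_nth.
Qed.

Lemma face_add_line y : y \in Y -> f y = 1 ->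
  (<<Y0>> + <[y]> <= <<Y>>)%VS /\ \dim (<<Y0>> + <[y]>)%VS = (\dim <<Y0>>%VS).+1.
Proof.
move=> yY fy; split.
  rewrite subv_add -memvE memv_span // andbT; apply: sub_span => z.
  by rewrite mem_filter => /andP[].
have f0 x : x \in <<Y0>>%VS -> f x = 0.
  by apply: form_eq0_span => z; rewrite mem_filter => /andP[/eqP].
rewrite dimv_disjoint_sum; last first.
  apply/eqP; rewrite -subv0; apply/subvP => x; rewrite memv_cap => /andP[/f0 fx /vlineP[c xE]].
  by move: fx; rewrite xE linearZ /= fy [_ *: _]mulr1 => ->; rewrite scale0r mem0v.
rewrite dim_vline; case: eqP => [y0|_]; last by rewrite addn1.
by move: fy; rewrite y0 linear0 => /esym/eqP; rewrite oner_eq0.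
Qed.

(** Vertices off the face that agree modulo its span add one dimension only. *)
Lemma facet_of_congruence y1 : Y0 != [::] -> y1 \in Y -> f y1 = 1 ->
  (forall y, y \in Y -> f y = 1 -> y - y1 \in <<Y0>>%VS) ->
  defines_facet (conv_hull [set y | y \in Y]) f 0.
Proof.
move=> n0 y1Y fy1 H; apply/defines_facet_dim; split.
  rewrite lt0n dimv_eq0; apply: contra n0 => /eqP Y00.
  case E : Y0 => [//|y l]; have yY0 : y \in Y0 by rewrite E mem_head.
  have : y \in <<Y0>>%VS by exact: memv_span.
  rewrite Y00 memv0 => /eqP y0; move: yY0; rewrite mem_filter => /andP[_ /hY].
  by rewrite y0 linear0 => /esym/eqP; rewrite oner_eq0.
have [sub <-] := face_add_line y1Y fy1; congr (\dim _).
apply/eqP; rewrite eqEsubv sub andbT; apply/span_subvP => y yY; case: (fY yY) => fy.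
  rewrite -[y]addr0; apply: memv_add; last exact: mem0v.
  by apply: memv_span; rewrite mem_filter fy eqxx.
by rewrite -(subrK y1 y) memv_add ?H ?memv_line.
Qed.

(** Modulo the span of a facet only a line remains. Two vertices with [f = 1] that such a [g]
    separates therefore refute a facet. *)
Lemma facet_form_constant (g : {linear V -> R^o}) y1 y2 :
  defines_facet (conv_hull [set y | y \in Y]) f 0 ->
  (forall y, y \in Y -> f y = 0 -> g y = 0) ->
  y1 \in Y -> y2 \in Y -> f y1 = 1 -> f y2 = 1 -> g y1 = g y2.
Proof.
move=> /defines_facet_dim[_ dE] g0 Y1 Y2 f1 f2.
have f0 x : x \in <<Y0>>%VS -> f x = 0.
  by apply: form_eq0_span => y; rewrite mem_filter => /andP[/eqP].
have {}g0 x : x \in <<Y0>>%VS -> g x = 0.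
  by apply: form_eq0_span => y; rewrite mem_filter => /andP[/eqP fy yY]; exact: g0.
have [sub dE'] := face_add_line Y2 f2.
have /eqP EY : (<<Y0>> + <[y2]>)%VS == <<Y>>%VS by rewrite eqEdim sub dE dE' leqnn.
have : y1 \in (<<Y0>> + <[y2]>)%VS by rewrite EY memv_span.
case/memv_addP => u uY0 [_ /vlineP[c ->] E].
have c1 : c = 1 by move: f1; rewrite E linearD linearZ /= f0 // f2 [_ *: _]mulr1 add0r.
by rewrite E c1 scale1r linearD /= g0 // add0r.
Qed.

End Facet.
End Dimension.

(** * Linear forms on the space of arc vectors *)

Section FunctionSpace.
Variables (R : realType) (A : finType).
Local Notation V := {ffun A -> R^o}.

Definition coord_form (a : A) (x : V) : R^o := x a.

Lemma coord_form_is_linear a : linear (coord_form a).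
Proof. by move=> c x y; rewrite /coord_form !ffunE. Qed.

HB.instance Definition _ a :=
  GRing.isLinear.Build R V R^o *:%R (coord_form a) (coord_form_is_linear a).

Definition dot_form (g : A -> R) (x : V) : R^o := \sum_a g a * x a.

Lemma dot_form_is_linear g : linear (dot_form g).
Proof.
move=> c x y; rewrite /dot_form scaler_sumr -big_split /=; apply: eq_bigr => a _.
by rewrite !ffunE mulrDr; congr (_ + _); exact: mulrCA.
Qed.

HB.instance Definition _ g :=
  GRing.isLinear.Build R V R^o *:%R (dot_form g) (dot_form_is_linear g).

Local Open Scope classical_set_scope.

(* Duality: a vector is in a subspace as soon as all forms vanishing on the
   subspace vanish on it; the coordinates of [x - projv U x] are enough forms. *)
Lemma facet_of_forms (h f : {linear V -> R^o}) (Y : seq V) y0 y1 :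
  (forall y, y \in Y -> h y = 1) -> (forall y, y \in Y -> f y = 0 \/ f y = 1) ->
  y0 \in Y -> f y0 = 0 -> y1 \in Y -> f y1 = 1 ->
  (forall e : {linear V -> R^o}, (forall y, y \in Y -> f y = 0 -> e y = 0) ->
     exists d : R, forall y, y \in Y -> e y = d * f y) ->
  defines_facet (conv_hull [set y | y \in Y]) f 0.
Proof.
move=> hY fY Y0 f0 Y1 f1 H; apply: (facet_of_congruence hY fY _ Y1 f1) => [|y yY fy].
  by rewrite -has_filter; apply/hasP; exists y0; rewrite ?f0.
set U := <<_>>%VS; set x := y - y1.
suff -> : x = projv U x by apply: memv_proj.
apply/ffunP => a; apply/eqP; rewrite -subr_eq0.
pose e : {linear V -> R^o} := coord_form a \o (\1 - projv U)%VF.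
have eE z : e z = z a - projv U z a by rewrite /e /= /coord_form !lfunE /= !lfunE /= !ffunE.
have [z zY fz|d dE] := H e.
  by rewrite eE projv_id ?subrr // memv_span // mem_filter fz eqxx.
by rewrite -eE /x linearB (dE _ yY) (dE _ Y1) fy f1 subrr.
Qed.

End FunctionSpace.

(** * Vertices of the path polytope *)

Section Vertices.
Variables (R : realType) (n : nat).
Local Notation T := {i : 'I_n.+1 | inner_node i}.
Local Notation V := {ffun arc_type n -> R^o}.
Implicit Types (l r : seq T) (x y : T).

Lemma inner_nodeE (i : 'I_n.+1) : inner_node i = (i != ord0) && (i != ord_max).
Proof.
rewrite /inner_node -!val_eqE /= lt0n ltn_neqAle; congr (_ && _).
by rewrite -ltnS ltn_ord andbT.
Qed.

Lemma card_inner_nodes : (0 < n)%N -> #|{: T}| = n.-1.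
Proof.
move=> n0; rewrite card_sig.
have E : predC (pred2 ord0 ord_max) =i [pred i : 'I_n.+1 | inner_node i].
  by move=> i; rewrite !inE inner_nodeE negb_or.
rewrite -(eq_card E); have := cardC (pred2 (@ord0 n) ord_max).
rewrite card2 card_ord; have -> : (ord0 != ord_max :> 'I_n.+1) by rewrite -val_eqE /= eq_sym -lt0n.
by move: #|_| => m; lia.
Qed.

Definition node_seq l : seq 'I_n.+1 := rcons (map val l) ord_max.

Definition path_vertex l : V := incidence R (path_arcs (node_seq l)).

Lemma inner_neq0 x : (val x == ord0) = false.
Proof. by have := valP x; rewrite inner_nodeE => /andP[/negbTE]. Qed.

Lemma inner_neqmax x : (val x == ord_max) = false.
Proof. by have := valP x; rewrite inner_nodeE => /andP[_ /negbTE]. Qed.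

Lemma path_node_seq l : uniq l -> l != [::] -> path (@is_arc n) ord0 (node_seq l).
Proof.
case: l => [|x r] // U _; rewrite /node_seq /= {1}/is_arc eqxx (valP x) /=.
elim: r x U => [|y r IH] x /=.
  by rewrite /is_arc (valP x) eqxx orbT.
rewrite inE negb_or -!andbA => /and3P[xy _ U]; rewrite IH // andbT.
by rewrite /is_arc (valP x) (valP y) val_eqE xy !orbT.
Qed.

Lemma uniq_node_seq l : uniq l -> uniq (node_seq l).
Proof.
move=> U; rewrite rcons_uniq map_inj_uniq ?U ?andbT; last exact: val_inj.
by apply/mapP => -[x _ /esym/eqP]; rewrite inner_neqmax.
Qed.

Lemma zip_path_arcs (s : seq 'I_n.+1) i e : path (@is_arc n) i s ->
  e \in zip (i :: s) s -> is_arc e.1 e.2.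
Proof.
elim: s i => [|j s IH] i //= /andP[ij ps]; rewrite inE => /orP[/eqP -> //|].
exact: IH.
Qed.

(** Listing the arc set along the walk turns sums over arcs into [path_value]; the pairs are
    distinct because their targets are. *)
Lemma perm_path_arcs l : uniq l -> l != [::] ->
  perm_eq (map val (enum (path_arcs (node_seq l)))) (zip (ord0 :: node_seq l) (node_seq l)).
Proof.
move=> U l0; apply: uniq_perm.
- by rewrite map_inj_uniq ?enum_uniq //; exact: val_inj.
- by apply: zip_uniqr; exact: uniq_node_seq.
move=> e; apply/mapP/idP => [[b + ->]|ez]; first by rewrite mem_enum inE.
exists (exist _ e (zip_path_arcs (path_node_seq U l0) ez)) => //.
by rewrite mem_enum inE.
Qed.

Lemma card_path_arcs l : uniq l -> l != [::] -> #|path_arcs (node_seq l)| = (size l).+1.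
Proof.
move=> U l0; rewrite cardE -(size_map val) (perm_size (perm_path_arcs U l0)).
by rewrite size_zip /= size_rcons size_map /minn ltnNge leqnSn.
Qed.

Lemma sum_path_arcs (G : 'I_n.+1 * 'I_n.+1 -> R) l : uniq l -> l != [::] ->
  \sum_(b in path_arcs (node_seq l)) G (val b) =
  path_value (fun x => G (ord0, val x)) (fun x => G (val x, ord_max))
    (fun x y => G (val x, val y)) l.
Proof.
move=> U l0; rewrite -big_enum /= -(big_map val xpredT) (perm_big _ (perm_path_arcs U l0)).
case: l l0 {U} => [|x r] // _; rewrite /node_seq /= big_cons -addrA; congr (_ + _).
elim: r x => [|y r IH] x /=; first by rewrite big_seq1 add0r.
by rewrite big_cons IH addrA.
Qed.

Lemma form_path_vertex (e : {linear V -> R^o}) :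
  exists s t w, forall l, uniq l -> l != [::] -> e (path_vertex l) = path_value s t w l.
Proof.
pose d b : V := [ffun a => (a == b)%:R].
(* [G] gives the values of [e] on unit vectors, with default 0 on pairs that are not arcs; no path
   meets such a pair. *)
pose G (i : 'I_n.+1 * 'I_n.+1) : R := if insub i is Some b then e (d b) else 0.
exists (fun x => G (ord0, val x)), (fun x => G (val x, ord_max)), (fun x y => G (val x, val y)).
move=> l U l0; rewrite -(sum_path_arcs G) //.
have -> : path_vertex l = \sum_(b in path_arcs (node_seq l)) d b.
  apply/ffunP => a; rewrite sum_ffunE ffunE.
  case: (boolP (a \in _)) => al.
    rewrite (bigD1 a) //= ffunE eqxx big1 ?addr0 // => b /andP[_ ba].
    by rewrite ffunE eq_sym (negbTE ba).
  rewrite big1 // => b bl; rewrite ffunE; case: eqP => // ab.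
  by rewrite ab bl in al.
by rewrite linear_sum; apply: eq_bigr => b _; rewrite /G valK.
Qed.

Lemma dot_path_vertex (G : 'I_n.+1 * 'I_n.+1 -> R) l : uniq l -> l != [::] ->
  dot_form (fun b => G (val b)) (path_vertex l) =
  path_value (fun x => G (ord0, val x)) (fun x => G (val x, ord_max))
    (fun x y => G (val x, val y)) l.
Proof.
move=> U l0; rewrite -sum_path_arcs // /dot_form [RHS]big_mkcond; apply: eq_bigr => b _.
by rewrite ffunE; case: ifP => _; rewrite ?mulr1 ?mulr0.
Qed.

Lemma coord_path_vertex a l : uniq l -> l != [::] ->
  path_vertex l a =
  path_value (fun x => ((ord0, val x) == val a)%:R) (fun x => ((val x, ord_max) == val a)%:R)
    (fun x y => ((val x, val y) == val a)%:R) l.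
Proof.
move=> U l0; rewrite -(sum_path_arcs (fun e => (e == val a)%:R)) // ffunE.
case: (boolP (a \in _)) => al.
  rewrite (bigD1 a) //= eqxx big1 ?addr0 // => b /andP[_ ba].
  by rewrite val_eqE (negbTE ba).
rewrite big1 // => b bl; rewrite val_eqE; case: eqP => // ab.
by rewrite -ab bl in al.
Qed.

Lemma is_0n_pathP (P : {set arc_type n}) : (0 < n)%N -> (1 < #|P|)%N -> is_0n_path P <->
  exists l, [/\ uniq l, l != [::] & P = path_arcs (node_seq l)].
Proof.
move=> n0 P1; split=> [[s [ps ls Us PE]]|[l [Ul l0 ->]]]; last first.
  exists (node_seq l); split=> //; [exact: path_node_seq|by rewrite last_rcons|].
  rewrite /= uniq_node_seq // andbT mem_rcons inE negb_or -val_eqE /= eq_sym -lt0n n0.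
  by apply/mapP => -[x _ /esym/eqP]; rewrite inner_neq0.
case: (lastP s) ls ps Us PE => [/esym/eqP|s' z]; first by rewrite -val_eqE /= -leqn0 leqNgt n0.
rewrite last_rcons => -> _; rewrite /= rcons_uniq mem_rcons inE negb_or.
case/and3P=> /andP[_ s0] sm Us PE.
have [l lE] : exists l, map val l = s'.
  elim: s' s0 sm {Us PE} => [|i s' IH]; first by exists [::].
  rewrite !inE !negb_or => /andP[i0 s0] /andP[im sm].
  have ii : inner_node i by rewrite inner_nodeE ![i == _]eq_sym i0.
  by have [l <-] := IH s0 sm; exists (exist _ i ii :: l).
exists l; split; rewrite /node_seq ?lE //; first by rewrite -(map_inj_uniq val_inj) lE.
(* Without inner nodes the only pair is (0, n), which is not an arc: the arc set would be empty. *)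
apply: contraTneq P1 => l0; rewrite -leqNgt PE -lE l0 /path_arcs /=.
rewrite eq_card0 // => a; rewrite !inE.
by case: a => b ba; apply/negP => /eqP /= bE; move: ba; rewrite bE /is_arc /inner_node /= ltnn andbF.
Qed.

Lemma path_polytope_vertices (c : seq nat) : (0 < n)%N -> all (fun k => 2 <= k <= n)%N c ->
  exists2 Y : seq V,
    path_polytope R n c = conv_hull [set y : V | y \in Y]%classic &
    forall y : V, y \in Y <-> exists l, [/\ uniq l, (size l).+1 \in c & y = path_vertex l].
Proof.
move=> n0 /allP cn; pose Q (P : {set arc_type n}) := `[< is_0n_path P >] && (#|P| \in c).
exists [seq incidence R P | P <- enum {set arc_type n} & Q P].
  congr (conv_hull _); apply/seteqP; split=> y.
    case=> P [P1 Pc ->]; apply/map_f; rewrite mem_filter mem_enum /Q Pc !andbT.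
    exact/asboolP.
  by case/mapP => P; rewrite mem_filter => /andP[/andP[/asboolP P1 Pc] _] ->; exists P.
move=> y; split=> [/mapP[P + ->]|[l [Ul lc ->]]].
  rewrite mem_filter => /andP[/andP[/asboolP P1 Pc] _].
  have /andP[P2 _] := cn _ Pc.
  have [l [Ul l0 PE]] := (is_0n_pathP n0 P2).1 P1; exists l; split=> //; last by rewrite PE.
  by rewrite -card_path_arcs // -PE.
have l0 : l != [::] by apply: contraTneq lc => ->; apply/negP => /cn.
apply/map_f; rewrite mem_filter mem_enum /Q card_path_arcs // lc !andbT; apply/asboolP.
by apply/is_0n_pathP; rewrite ?card_path_arcs //; [case: (l) l0|exists l].
Qed.

End Vertices.

(** * Facet criteria in terms of path values *)

Section PathFacets.
Variables (R : realType) (n : nat).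
Local Notation T := {i : 'I_n.+1 | inner_node i}.
Local Notation V := {ffun arc_type n -> R^o}.
Implicit Types (l r : seq T) (x y p q : T) (c : seq nat) (a : arc_type n).

Lemma path_vertex01 l a : path_vertex R l a = 0 \/ path_vertex R l a = 1.
Proof. by rewrite ffunE; case: (a \in _); [right|left]. Qed.

Lemma source_form_path_vertex l : uniq l -> l != [::] ->
  dot_form (fun b : arc_type n => ((val b).1 == ord0)%:R) (path_vertex R l) = 1.
Proof.
move=> U l0; rewrite (dot_path_vertex (fun e => (e.1 == ord0)%:R)) //.
rewrite (@eq_path_value _ _ _ (fun=> 1) _ (fun=> 0) _ (fun _ _ => 0)) //.
- by case: l l0 {U} => // x r _; rewrite /= walk_sum_const; ring.
- by move=> x; rewrite inner_neq0.
- by move=> x y _; rewrite inner_neq0.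
Qed.

Variables (c : seq nat) (a : arc_type n).
Hypotheses (n0 : (0 < n)%N) (cn : all (fun k => 2 <= k <= n)%N c).

Lemma size_in_neq0 l : (size l).+1 \in c -> l != [::].
Proof. by case: l => // /(allP cn). Qed.

Lemma facet_of_path_values l0 l1 :
  uniq l0 -> (size l0).+1 \in c -> path_vertex R l0 a = 0 ->
  uniq l1 -> (size l1).+1 \in c -> path_vertex R l1 a = 1 ->
  (forall (s t : T -> R) w,
    (forall l, uniq l -> (size l).+1 \in c -> path_vertex R l a = 0 -> path_value s t w l = 0) ->
    exists d : R, forall l, uniq l -> (size l).+1 \in c ->
      path_value s t w l = d * path_vertex R l a) ->
  defines_facet (path_polytope R n c) (fun z => z a) 0.
Proof.
move=> U0 c0 f0 U1 c1 f1 H; have [Y -> YP] := path_polytope_vertices R n0 cn.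
apply: (@facet_of_forms _ _ (dot_form (fun b : arc_type n => ((val b).1 == ord0)%:R))
  (coord_form a) Y (path_vertex R l0) (path_vertex R l1)) => //.
- by move=> y /YP[l [Ul lc ->]]; apply: source_form_path_vertex; rewrite // size_in_neq0.
- by move=> y /YP[l [Ul lc ->]]; exact: path_vertex01.
- by apply/YP; exists l0.
- by apply/YP; exists l1.
move=> e e0; have [s [t [w E]]] := form_path_vertex e.
have [l Ul lc fl|d dE] := H s t w.
  by rewrite -E ?size_in_neq0 // e0 //; apply/YP; exists l.
exists d => y /YP[l [Ul lc ->]]; rewrite E ?size_in_neq0 //; exact: dE.
Qed.

Lemma facet_path_value_constant (G : 'I_n.+1 * 'I_n.+1 -> R) l1 l2 :
  let pv := path_value (fun x : T => G (ord0, val x)) (fun x => G (val x, ord_max))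
    (fun x y => G (val x, val y)) in
  defines_facet (path_polytope R n c) (fun z => z a) 0 ->
  (forall l, uniq l -> (size l).+1 \in c -> path_vertex R l a = 0 -> pv l = 0) ->
  uniq l1 -> (size l1).+1 \in c -> path_vertex R l1 a = 1 ->
  uniq l2 -> (size l2).+1 \in c -> path_vertex R l2 a = 1 -> pv l1 = pv l2.
Proof.
move=> pv; have [Y -> YP] := path_polytope_vertices R n0 cn => F H U1 c1 f1 U2 c2 f2.
rewrite /pv -!dot_path_vertex ?size_in_neq0 //.
apply: (@facet_form_constant _ _ (dot_form (fun b : arc_type n => ((val b).1 == ord0)%:R))
  (coord_form a) Y) => //.
- by move=> y /YP[l [Ul lc ->]]; apply: source_form_path_vertex; rewrite // size_in_neq0.
- by move=> y /YP[l [Ul lc ->]]; exact: path_vertex01.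
- by move=> y /YP[l [Ul lc ->]] fl /=; rewrite dot_path_vertex ?size_in_neq0 //; exact: H.
- by apply/YP; exists l1.
- by apply/YP; exists l2.
Qed.

End PathFacets.

(** * Facets from inner, initial and final arcs *)

Section Cases.
Variables (R : realType) (n : nat).
Local Notation T := {i : 'I_n.+1 | inner_node i}.
Implicit Types (l r : seq T) (x y p q : T) (c : seq nat) (a : arc_type n).

Lemma arc_typeP a :
  [\/ exists p q : T, [/\ p != q, val a = (val p, val q) & inner_arc a],
      exists2 p : T, val a = (ord0, val p) & ~~ inner_arc a |
      exists2 p : T, val a = (val p, ord_max) & ~~ inner_arc a].
Proof.
have := valP a; rewrite /inner_arc; case: (val a) => i j /= /or3P[].
- case/andP=> /eqP -> jj; apply: Or32; exists (exist _ j jj) => //.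
- case/andP=> ii /eqP ->; apply: Or33; exists (exist _ i ii) => //.
  by rewrite /inner_node ltnn !andbF.
case/and3P=> ii jj nij; apply: Or31; exists (exist _ i ii), (exist _ j jj).
by rewrite -val_eqE ii jj.
Qed.

Lemma inner_coord a p q l : val a = (val p, val q) -> uniq l -> l != [::] ->
  path_vertex R l a = arc_count R p q l.
Proof.
move=> aE U l0; rewrite coord_path_vertex // aE; apply: eq_path_value => //.
- by move=> x; rewrite xpair_eqE eq_sym inner_neq0.
- by move=> x; rewrite xpair_eqE [ord_max == _]eq_sym inner_neqmax andbF.
Qed.

Lemma start_coord a p x r : val a = (ord0, val p) -> uniq (x :: r) ->
  path_vertex R (x :: r) a = (x == p)%:R.
Proof.
move=> aE U; rewrite coord_path_vertex // aE.
rewrite (@eq_path_value _ _ _ (fun z => (z == p)%:R) _ (fun=> 0) _ (fun _ _ => 0)) //.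
- by rewrite /= walk_sum_const; ring.
- by move=> z; rewrite xpair_eqE inner_neq0.
- by move=> y z _; rewrite xpair_eqE inner_neq0.
Qed.

Lemma end_coord a p x r : val a = (val p, ord_max) -> uniq (x :: r) ->
  path_vertex R (x :: r) a = (last x r == p)%:R.
Proof.
move=> aE U; rewrite coord_path_vertex // aE.
rewrite (@eq_path_value _ _ _ (fun=> 0) _ (fun z => (z == p)%:R) _ (fun _ _ => 0)) //.
- by rewrite /= walk_sum_const; ring.
- by move=> z; rewrite xpair_eqE eq_sym inner_neq0.
- by move=> z; rewrite xpair_eqE eqxx andbT.
- by move=> y z _; rewrite xpair_eqE inner_neqmax andbF.
Qed.

Lemma sorted_subset2 c i j : (i < j)%N -> sorted ltn c -> (2 <= size c)%N ->
  {subset c <= [:: i; j]} -> c = [:: i; j].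
Proof.
case: c => [|k1 [|k2 c]] // ij /= /andP[k12 sc] _ sub.
have := sub k1; have := sub k2; rewrite !inE !eqxx !orbT => /(_ isT) h2 /(_ isT) h1.
have [k1E k2E] : k1 = i /\ k2 = j by move: h1 h2 => /orP[] /eqP ? /orP[] /eqP ?; lia.
case: c sc sub => [|k3 c]; first by rewrite k1E k2E.
move=> /= /andP[k23 _] /(_ k3); rewrite !inE eqxx !orbT => /(_ isT) h3.
by exfalso; move: h3 => /orP[] /eqP ?; lia.
Qed.

Section Facets.
Variables (c : seq nat) (a : arc_type n).
Hypotheses (n4 : (4 <= n)%N) (c2 : (2 <= size c)%N) (sc : sorted ltn c)
  (cn : all (fun k => 2 <= k <= n)%N c).

Let n0 : (0 < n)%N. Proof. exact: leq_trans n4. Qed.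
Let cT : #|{: T}| = n.-1. Proof. exact: card_inner_nodes. Qed.

(** As all lengths are at least 2, the second one is at least 3. A path with two or more inner nodes
    differs from its reversal, and such a pair provides the vertices on and off the face. *)
Lemma long_length : exists2 k, (2 <= k <= #|{: T}|)%N & k.+1 \in c.
Proof.
case: c c2 sc cn => [|k1 [|k2 c']] //= _ /andP[k12 _] /and3P[h1 h2 _].
by exists k2.-1; rewrite ?cT ?prednK ?inE ?eqxx ?orbT //; lia.
Qed.

Lemma inner_facet p q : val a = (val p, val q) -> p != q ->
  c <> [:: 2; n]%N \/ c = [:: 2; n]%N /\ (5 <= n)%N ->
  defines_facet (path_polytope R n c) (fun z => z a) 0.
Proof.
move=> aE pq cc; have [k /andP[k2 kT] kc] := long_length.
have [||r sr Ur] := @ex_uniq_extension T [:: p; q] (k - 2)%N.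
- by rewrite /= inE pq.
- by rewrite -[size _]/2%N subnKC.
have {}Ur : uniq [:: p, q & r] by [].
have sl : (size [:: p, q & r]).+1 \in c by rewrite /= sr (_ : (k - 2).+3 = k.+1)%N //; clear -k2; lia.
have cE l : uniq l -> (size l).+1 \in c -> path_vertex R l a = arc_count R p q l.
  by move=> U lc; rewrite (inner_coord aE) // (size_in_neq0 cn).
have f1 : path_vertex R [:: p, q & r] a = 1.
  have pqr : p \notin q :: r by case/andP: Ur.
  rewrite cE // arc_count_cons /= arc_at_nosource; first by rewrite /arc_at !eqxx addr0.
  by apply: contra pqr; exact: mem_belast.
have f0 : path_vertex R (rev [:: p, q & r]) a = 0.
  rewrite cE ?rev_uniq ?size_rev //; case: (arc_count_antisym R p q Ur) => //.
  by rewrite -cE // f1 => /eqP; rewrite oner_eq0.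
apply: (facet_of_path_values n0 cn _ _ f0 _ _ f1); rewrite ?rev_uniq ?size_rev //.
move=> s t w van.
have van' l : uniq l -> (size l).+1 \in c -> arc_count R p q l = 0 -> path_value s t w l = 0.
  by move=> U lc E; apply: van; rewrite // cE.
suff [d dE] : exists d, forall l, uniq l -> (size l).+1 \in c ->
    path_value s t w l = d * arc_count R p q l.
  by exists d => l U lc; rewrite cE //; exact: dE.
(* Lengths count arcs, one more than the inner nodes, so the range 2, ..., n - 2 becomes 3 <= j <
   n. *)
case: (boolP (has (fun j => 3 <= j < n)%N c)) => [/hasP[j jc hj]|/hasPn nh].
  apply: (@inner_arc_mid_length _ _ (fun k => k.+1 \in c) _ _ _ _ _ pq van' j.-1).
    by rewrite prednK //; lia.
  by rewrite cT; lia.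
have cE2 : c = [:: 2; n]%N.
  apply: sorted_subset2 => //; first exact: leq_trans n4.
  move=> j jc; rewrite !inE; have := nh j jc; have := allP cn j jc; lia.
case: cc => [//|[_ n5]].
have [|||d dE] := @inner_arc_extreme_lengths _ _ (fun k => k.+1 \in c) _ _ _ _ _ pq van'.
- by rewrite cE2.
- by rewrite cT prednK // cE2 !inE eqxx orbT.
- by rewrite cT; lia.
by exists d => l U _; exact: dE.
Qed.

Hypotheses (c23 : c <> [:: 2; 3]%N) (c2n : c <> [:: 2; n]%N).

(** Without a length strictly between 3 and n, all lengths are among 2, 3 and n. Then excluding (2,
    n) forces 3 and excluding (2, 3) forces n: paths with two and with all inner nodes are
    available. *)
Lemma boundary_values (s t : T -> R) w p :
  (forall x r, uniq (x :: r) -> (size r).+2 \in c -> x != p -> path_value s t w (x :: r) = 0) ->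
  exists d : R, forall x r, uniq (x :: r) -> (size r).+2 \in c ->
    path_value s t w (x :: r) = d * (x == p)%:R.
Proof.
move=> van.
case: (boolP (has (fun j => 4 <= j < n)%N c)) => [/hasP[j jc hj]|/hasPn nh].
  apply: (@start_arc_mid_length _ _ (fun k => k.+1 \in c) _ _ _ _ van j.-1).
    by rewrite prednK //; lia.
  by rewrite cT; lia.
have c3 : 3%N \in c.
  have [//|n3] := boolP (3%N \in c); case: c2n; apply: sorted_subset2 => //; first exact: leq_trans n4.
  move=> j jc; rewrite !inE; have := nh j jc; have := allP cn j jc.
  have : j != 3%N by apply: contraNneq n3 => <-.
  lia.
have cn' : n \in c.
  have [//|n3] := boolP (n \in c); case: c23; apply: sorted_subset2 => //.
  move=> j jc; rewrite !inE; have := nh j jc; have := allP cn j jc.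
  have : j != n by apply: contraNneq n3 => <-.
  lia.
have [|||d dE] := @start_arc_two_and_full _ _ (fun k => k.+1 \in c) _ _ _ _ van.
- exact: c3.
- by rewrite cT prednK.
- by rewrite cT; lia.
by exists d => x r U _; exact: dE.
Qed.

Lemma start_facet p : val a = (ord0, val p) ->
  defines_facet (path_polytope R n c) (fun z => z a) 0.
Proof.
move=> aE; have [k /andP[k2 kT] kc] := long_length.
have [||r sr Ur] := @ex_uniq_extension T [:: p] k.-1; first by [].
  by rewrite -[size _]/1%N add1n prednK // ltnW.
have {}Ur : uniq (p :: r) by [].
have sl : (size (p :: r)).+1 \in c by rewrite /= sr prednK //; lia.
have f1 : path_vertex R (p :: r) a = 1 by rewrite (start_coord aE) // eqxx.
have f0 : path_vertex R (rev (p :: r)) a = 0.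
  rewrite lastI rev_rcons (start_coord aE); last by rewrite -rev_rcons -lastI rev_uniq.
  case: r sr Ur {sl f1} => [|y r] sr; first by move: sr; rewrite /=; lia.
  case/andP=> pr _; case: eqP => // pE; have := mem_last y r.
  by rewrite (pE : last y r = p) (negbTE pr).
apply: (facet_of_path_values n0 cn _ _ f0 _ _ f1); rewrite ?rev_uniq ?size_rev //.
move=> s t w van; have [x r' U rc xp|d dE] := @boundary_values s t w p.
  by apply: van => //; rewrite (start_coord aE) // (negbTE xp).
exists d => -[|x r'] U lc; first by have := size_in_neq0 cn lc.
by rewrite (start_coord aE) //; exact: dE.
Qed.

(** Reversal swaps [s] and [t] and transposes [w], so the values computed for (0, p) carry over. *)
Lemma end_facet p : val a = (val p, ord_max) ->
  defines_facet (path_polytope R n c) (fun z => z a) 0.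
Proof.
move=> aE; have [k /andP[k2 kT] kc] := long_length.
have [||r sr Ur] := @ex_uniq_extension T [:: p] k.-1; first by [].
  by rewrite -[size _]/1%N add1n prednK // ltnW.
have {}Ur : uniq (p :: r) by [].
have sl : (size (p :: r)).+1 \in c by rewrite /= sr prednK //; lia.
have coordE x l : uniq (x :: l) -> path_vertex R (rev (x :: l)) a = (x == p)%:R.
  move=> U; rewrite lastI rev_rcons (end_coord aE); last by rewrite -rev_rcons -lastI rev_uniq.
  by rewrite last_rev_belast.
have f1 : path_vertex R (rev (p :: r)) a = 1 by rewrite coordE // eqxx.
have f0 : path_vertex R (p :: r) a = 0.
  rewrite (end_coord aE) //.
  case: r sr Ur {sl f1} => [|y r] sr; first by move: sr; rewrite /=; lia.
  case/andP=> pr _; case: eqP => // pE; have := mem_last y r.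
  by rewrite (pE : last y r = p) (negbTE pr).
apply: (facet_of_path_values n0 cn _ _ f0 _ _ f1); rewrite ?rev_uniq ?size_rev //.
move=> s t w van; have [x r' U rc xp|d dE] := @boundary_values t s (fun u v => w v u) p.
  rewrite -path_value_rev; apply: van; rewrite ?rev_uniq ?size_rev //.
  by rewrite coordE // (negbTE xp).
exists d => l U lc; rewrite -(revK l) path_value_rev.
have {U} : uniq (rev l) by rewrite rev_uniq.
have {lc} : (size (rev l)).+1 \in c by rewrite size_rev.
case: (rev l) => [|x r'] lc U; first by have := size_in_neq0 cn lc.
by rewrite coordE //; exact: dE.
Qed.

End Facets.

End Cases.

(* For [n = 4] this form separates the paths p, q, r and r, p, q: its values are 1 and -1. *)
Lemma three_node_value (R : realFieldType) (T : finType) (p q r : T) (l : seq T) :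
  p != q -> p != r -> q != r -> (forall x, x \in [:: p; q; r]) ->
  uniq l -> size l = 1%N \/ size l = 3 -> arc_count R p q l = 0 ->
  path_value (fun=> 0) (fun=> 0) (fun x y => arc_at R q r x y - arc_at R r p x y) l = 0.
Proof.
move=> pq pr qr all3 U sl.
have qp : q != p by rewrite eq_sym.
have rp : r != p by rewrite eq_sym.
have rq : r != q by rewrite eq_sym.
pose simp := (eqxx, negbTE pq, negbTE pr, negbTE qr, negbTE qp, negbTE rp, negbTE rq).
have [s1|s3] := sl.
  by case: l s1 {U sl} => [|x []] //= _ _; rewrite !addr0.
case: l s3 U {sl} => [|x [|y [|z []]]] // _.
rewrite arc_count_cons /= !inE !negb_or /arc_at.
have := all3 x; have := all3 y; have := all3 z; rewrite !inE.
by case/or3P=> /eqP -> /or3P[] /eqP -> /or3P[] /eqP ->; rewrite !simp //= => _; lra.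
Qed.

(** * Failure for the lengths (2, n) *)

Section NonFacets.
Variables (R : realType) (n : nat).
Local Notation T := {i : 'I_n.+1 | inner_node i}.
Implicit Types (l r : seq T) (x y p q : T) (a : arc_type n).
Hypothesis n4 : (4 <= n)%N.

Let c := [:: 2; n]%N.
Let n0 : (0 < n)%N. Proof. exact: leq_trans n4. Qed.
Let cT : #|{: T}| = n.-1. Proof. exact: card_inner_nodes. Qed.
Let cn : all (fun k => 2 <= k <= n)%N c.
Proof. by rewrite /= leqnn !andbT (leq_trans _ n4) //= (leq_trans _ n4). Qed.

(** Every visited node is entered by exactly one arc, so charging [N] to the arcs entering p counts
    the visit to p, whether it comes from 0 or from an inner node. *)
Lemma visit_value (N : R) p x r : uniq (x :: r) ->
  path_value (fun y => N * (y == p)%:R) (fun=> 0) (fun _ y => N * (y == p)%:R - 1) (x :: r) =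
  N * (p \in x :: r)%:R - (size r)%:R.
Proof.
have W z l : uniq l ->
    walk_sum (fun _ y => N * (y == p)%:R - 1) z l = N * (p \in l)%:R - (size l)%:R.
  elim: l z => [|y l IH] z /=; first by rewrite mulr0 subr0.
  case/andP=> yl U; rewrite IH // inE (eq_sym p) -[(size l).+1%:R]natr1.
  have [yp|_] := eqVneq y p; last by rewrite /=; ring.
  by rewrite -yp (negbTE yl) /=; ring.
case/andP=> xr U; rewrite /= W // inE (eq_sym p).
have [xp|_] := eqVneq x p; last by rewrite /=; ring.
by rewrite -xp (negbTE xr) /=; ring.
Qed.

(* The form (n - 2) (visits to p) - (number of inner arcs) vanishes on all
   vertices except the path 0, p, n, but both that path and some Hamiltonian
   path use the arc. *)
Lemma boundary_not_facet a p :
  val a = (ord0, val p) \/ val a = (val p, ord_max) ->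
  ~ defines_facet (path_polytope R n c) (fun z => z a) 0.
Proof.
(* A Hamiltonian path has n - 2 inner arcs, which its single visit to p has to offset. *)
move=> aE F; pose N : R := n.-2%:R.
pose G (e : 'I_n.+1 * 'I_n.+1) : R :=
  N * (e.2 == val p)%:R - (inner_node e.1 && inner_node e.2)%:R.
set pv := path_value (fun x : T => G (ord0, val x)) (fun x => G (val x, ord_max))
  (fun x y => G (val x, val y)).
have pvE x r : uniq (x :: r) -> pv (x :: r) = N * (p \in x :: r)%:R - (size r)%:R.
  move=> U; rewrite -visit_value //; apply: eq_path_value => // [y|y|y z _]; rewrite /G /=.
  - by rewrite subr0 val_eqE.
  - by rewrite eq_sym inner_neqmax [inner_node ord_max]inner_nodeE eqxx !andbF mulr0 subr0.
  - by rewrite (valP y) (valP z) val_eqE.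
have full l : uniq l -> size l = n.-1 -> p \in l.
  move=> U sl; apply: contraT => pl; have U' : uniq (p :: l) by rewrite /= pl.
  have := max_card (mem (p :: l)); rewrite (card_uniqP U') cT -[size _]/(size l).+1 sl.
  by rewrite ltnn.
have van l : uniq l -> (size l).+1 \in c -> path_vertex R l a = 0 -> pv l = 0.
  case: l => [|x r] U lc; first by have := size_in_neq0 cn lc.
  move: lc; rewrite !inE => /orP[/eqP[]|/eqP sr _].
    case: r U => // U _; rewrite pvE // mem_seq1 (eq_sym p).
    by case: aE => aE; rewrite ?(start_coord _ aE) ?(end_coord _ aE) //= => ->; rewrite mulr0 subr0.
  rewrite pvE // full //; last exact: (congr1 predn sr).
  by rewrite /N -(congr1 (fun k => k.-2) sr) mulr1 subrr.
have [||r sr Ur] := @ex_uniq_extension T [:: p] n.-2; first by [].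
  by rewrite cT -[size _]/1%N add1n prednK //; lia.
have {}Ur : uniq (p :: r) by [].
have szr : (size r).+2 = n by rewrite sr; lia.
have p2 : path_vertex R [:: p] a = 1.
  by case: aE => aE; rewrite ?(start_coord _ aE) ?(end_coord _ aE) //= eqxx.
have [l [Ul sl fl]] : exists l, [/\ uniq l, size l = n.-1 & path_vertex R l a = 1].
  case: aE => aE; [exists (p :: r)|exists (rev (p :: r))].
    by split=> //; [exact: (congr1 predn szr)|rewrite (start_coord _ aE) // eqxx].
  rewrite rev_uniq size_rev; split=> //; first exact: (congr1 predn szr).
  rewrite lastI rev_rcons (end_coord _ aE); last by rewrite -rev_rcons -lastI rev_uniq.
  by rewrite last_rev_belast eqxx.
have := facet_path_value_constant n0 cn F van (l1 := [:: p]) (l2 := l).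
rewrite -/pv Ul p2 fl sl prednK // !inE eqxx orbT => /(_ isT isT erefl isT isT erefl).
case: l Ul sl {fl} => [|x l] Ul sl; first by move: sl => /=; lia.
rewrite !pvE // (full (x :: l)) // mem_head /N (congr1 predn sl : size l = n.-2).
by rewrite mulr1 subrr subr0 => /eqP; rewrite pnatr_eq0; clear -n4; lia.
Qed.

(** Only the cycle p, r, q avoids (p, q), so the arcs (q, r) and (r, p) of the other cycle are free
    to get opposite costs: q, r, p avoids (p, q) and uses both, while p, q, r and r, p, q use one
    each. *)
Lemma inner_not_facet4 a p q : n = 4%N -> p != q -> val a = (val p, val q) ->
  ~ defines_facet (path_polytope R n c) (fun z => z a) 0.
Proof.
move=> nE pq aE F.
have cT3 : #|{: T}| = 3%N := etrans cT (congr1 predn nE).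
have c4 : c = [:: 2; 4]%N := congr1 (fun k => [:: 2; k]%N) nE.
have [||[|r []] // _] := @ex_uniq_extension T [:: p; q] 1; first by rewrite /= inE pq.
  by rewrite cT3.
rewrite [uniq _]/= !inE !negb_or !andbT => /andP[/andP[_ pr] qr].
have U3 : uniq [:: p; q; r] by rewrite /= !inE negb_or pq pr qr.
have all3 x : x \in [:: p; q; r].
  have sub : {subset [:: p; q; r] <= enum {: T}} by move=> y _; rewrite mem_enum.
  have [|_ ->] := uniq_min_size U3 sub; last by rewrite mem_enum.
  by rewrite -cardE cT3.
pose G (e : 'I_n.+1 * 'I_n.+1) : R :=
  (e == (val q, val r))%:R - (e == (val r, val p))%:R.
set pv := path_value (fun x : T => G (ord0, val x)) (fun x => G (val x, ord_max))
  (fun x y => G (val x, val y)).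
pose w x y : R := arc_at R q r x y - arc_at R r p x y.
have pvE l : uniq l -> pv l = path_value (fun=> 0) (fun=> 0) w l.
  move=> U; apply: eq_path_value => // [y|y]; rewrite /G !xpair_eqE.
    by rewrite ![ord0 == _]eq_sym !inner_neq0 subrr.
  by rewrite ![ord_max == _]eq_sym !inner_neqmax !andbF subrr.
have qp : q != p by rewrite eq_sym.
have rp : r != p by rewrite eq_sym.
have rq : r != q by rewrite eq_sym.
pose simp := (eqxx, negbTE pq, negbTE pr, negbTE qr, negbTE qp, negbTE rp, negbTE rq).
have cE l : uniq l -> (size l).+1 \in c -> path_vertex R l a = arc_count R p q l.
  by move=> U lc; rewrite (inner_coord _ aE) // (size_in_neq0 cn).
have van l : uniq l -> (size l).+1 \in c -> path_vertex R l a = 0 -> pv l = 0.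
  move=> U lc E; rewrite pvE //; apply: (three_node_value pq pr qr all3 U); last by rewrite -cE.
  by move: lc; rewrite c4 !inE => /orP[] /eqP[]; [left|right].
have l3 : 4%N \in c by rewrite c4.
have U3' : uniq [:: r; p; q] by rewrite /= !inE !simp.
have := facet_path_value_constant n0 cn F van (l1 := [:: p; q; r]) (l2 := [:: r; p; q]).
rewrite -/pv !cE // !pvE //.
have E1 : arc_count R p q [:: p; q; r] = 1.
  by rewrite arc_count_cons /= /arc_at !simp /= !addr0.
have E2 : arc_count R p q [:: r; p; q] = 1.
  by rewrite arc_count_cons /= /arc_at !simp /= add0r addr0.
by move=> /(_ U3 l3 E1 U3' l3 E2); rewrite /w /= /arc_at !simp /=; lra.
Qed.

End NonFacets.

(** * The equivalence, by length sequence and kind of arc *)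

Theorem theorem8 (R : realType) (n : nat) (c : seq nat) (a : arc_type n) :
  (4 <= n)%N ->
  (2 <= size c)%N ->
  sorted ltn c ->
  all (fun p => 2 <= p <= n)%N c ->
  c <> [:: 2; 3]%N ->
  (defines_facet (path_polytope R n c) (fun x => x a) 0 <->
   (c <> [:: 2; n]%N \/ (c = [:: 2; n]%N /\ (5 <= n)%N /\ inner_arc a))).
Proof.
move=> n4 c2 sc cn c23.
have [cE|c2n] := eqVneq c [:: 2; n]%N; last first.
  split=> [_|_]; first by left; exact/eqP.
  have {}c2n : c <> [:: 2; n]%N by exact/eqP.
  have [[p [q [pq aE _]]]|[p aE _]|[p aE _]] := arc_typeP a.
  - by apply: (inner_facet R n4 c2 sc cn aE pq); left.
  - exact: (start_facet R n4 c2 sc cn c23 c2n aE).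
  - exact: (end_facet R n4 c2 sc cn c23 c2n aE).
have [[p [q [pq aE ia]]]|[p aE na]|[p aE na]] := arc_typeP a.
- split=> [F|H].
    right; split=> //; split=> //; rewrite ltn_neqAle n4 andbT eq_sym; apply/eqP => nE.
    by rewrite cE in F; exact: (inner_not_facet4 n4 nE pq aE F).
  apply: (inner_facet R n4 c2 sc cn aE pq); case: H => [|[_ []]]; by [left|right].
- split=> [F|[|[_ [_]]]] //; last by rewrite (negbTE na).
  by rewrite cE in F; case: (boundary_not_facet n4 (or_introl aE) F).
- split=> [F|[|[_ [_]]]] //; last by rewrite (negbTE na).
  by rewrite cE in F; case: (boundary_not_facet n4 (or_intror aE) F).
Qed.
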